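(* Suppose $\mu/\nu$ is a skew shape with $|\mu/\nu|=N$ such that $\mu_i=\nu_i$ for some $i\in[n]$, where $n\ge\ell(\mu/\nu)$. Let $\widehat\mu$ and $\widehat\nu$ denote, respectively, the partitions $\mu$ and $\nu$ with their $i$-th components removed. Then $\Gamma^\theta_{\mu/\nu}(w)=\Gamma^\theta_{\widehat\mu/\widehat\nu}(w)$ for all $w\in S_n$ and all $\theta\vdash N$.
   Context: $[n]=\{1,\ldots,n\}$. Partitions are weakly decreasing sequences of positive integers, extended by zeros when needed ($\nu$ may be empty). A skew shape $\mu/\nu$ is a pair of partitions with $\nu_i\le\mu_i$ for all $i$; its length $\ell(\mu/\nu)$ is the largest $i$ with $\nu_i<\mu_i$, and $|\mu/\nu|=\sum_i(\mu_i-\nu_i)$. For $\theta\vdash N$ and an integer sequence $c=(c_1,\ldots,c_n)$ summing to $N$, the Kostka number $K_{\theta,c}$ is the number of semistandard Young tableaux of shape $\theta$ with content $c$; it is $0$ if some $c_i<0$. For $n\ge\ell(\mu/\nu)$ let $\delta=(n-1,\ldots,1,0)$, regard $\mu,\nu$ as their first $n$ entries, and let $w\in S_n$ act by $w(a_1,\ldots,a_n)=(a_{w^{-1}(1)},\ldots,a_{w^{-1}(n)})$. For $\theta\vdash N=|\mu/\nu|$ the immanant character $\Gamma^\theta_{\mu/\nu}:S_n\to\mathbb{Z}$ is $$\Gamma^\theta_{\mu/\nu}(w)=\frac{n!}{|C(w)|}\sum_{w'\in C(w)}K_{\theta,\ \mu+\delta-w'(\nu+\delta)},$$ where $C(w)$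 is the conjugacy class of $w$ in $S_n$. Both sides of the claimed equality are taken as functions on the same $S_n$. *)

(* Defs.v *)
From mathcomp Require Import all_boot all_order all_algebra all_fingroup.

Set Implicit Arguments.
Unset Strict Implicit.
Unset Printing Implicit Defensive.

Local Open Scope nat_scope.

(* All indices are 0-based: the i-th part of s in 1-based notation is
   [part s (i - 1)], and index i : 'I_n stands for i + 1 in {1, ..., n}. *)
Definition part (s : seq nat) (i : nat) : nat := nth 0 s i.

Definition is_intpart (s : seq nat) : bool :=
  sorted geq s && (0 \notin s).

Definition is_intpart_of (N : nat) (s : seq nat) : bool :=
  is_intpart s && (sumn s == N).

Definition is_skew_shape (mu nu : seq nat) : Prop :=
  [/\ is_intpart mu, is_intpart nu & forall i, part nu i <= part mu i].

(* The ranges below stop at [size mu]: all later parts of a skew shape vanish. *)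
Definition skew_length (mu nu : seq nat) : nat :=
  \max_(i < size mu | part nu i < part mu i) i.+1.

Definition skew_size (mu nu : seq nat) : nat :=
  \sum_(i < size mu) (part mu i - part nu i).

(* If [size s <= i] the deleted component is a trailing zero and the result
   is s itself. *)
Definition delete_part (i : nat) (s : seq nat) : seq nat :=
  take i s ++ drop i.+1 s.

Definition cell (theta : seq nat) := {r : 'I_(size theta) & 'I_(part theta r)}.

Definition cell_row (theta : seq nat) (x : cell theta) : nat := tag x.
Definition cell_col (theta : seq nat) (x : cell theta) : nat := tagged x.

Definition is_ssyt (theta : seq nat) (n : nat)
    (T : {ffun cell theta -> 'I_n}) : bool :=
  [forall x, forall y,
    ((cell_row x == cell_row y) && (cell_col x < cell_col y) ==> (T x <= T y))
    && ((cell_col x == cell_col y) && (cell_row x < cell_row y)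
        ==> (T x < T y))].

(* The content is compared in int, so no tableau has content c when c has a
   negative entry. *)
Definition has_content (theta : seq nat) (n : nat)
    (T : {ffun cell theta -> 'I_n}) (c : 'I_n -> int) : bool :=
  [forall k, Posz #|[set x | T x == k]| == c k].

Definition kostka (theta : seq nat) (n : nat) (c : 'I_n -> int) : nat :=
  #|[set T : {ffun cell theta -> 'I_n} | is_ssyt T && has_content T c]|.

Definition delta (n : nat) (i : 'I_n) : nat := n - i.+1.

Definition shifted (n : nat) (s : seq nat) (i : 'I_n) : int :=
  Posz (part s i + delta i).

Definition perm_act (n : nat) (w : 'S_n) (a : 'I_n -> int) : 'I_n -> int :=
  fun i => a ((w^-1)%g i).

Definition conj_class (n : nat) (w : 'S_n) : {set 'S_n} :=
  (w ^: [set: 'S_n])%g.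

(* Hence the Euclidean division in [imm_char] is exact. *)
Lemma card_conj_class_dvd (n : nat) (w : 'S_n) : #|conj_class w| %| n`!.
Proof.
by rewrite /conj_class -index_cent1 -card_Sn -cardsT dvdn_indexg.
Qed.

Definition imm_char (n : nat) (theta mu nu : seq nat) (w : 'S_n) : int :=
  (Posz (n`! %/ #|conj_class w|) *
   \sum_(w' in conj_class w)
     Posz (kostka theta
             (fun k => shifted mu k - perm_act w' (shifted nu) k)))%R.

(* Main.v *)
Require Import Defs.
From mathcomp Require Import all_boot all_order all_algebra all_fingroup.
From mathcomp Require Import zify.

Set Implicit Arguments.
Unset Strict Implicit.
Unset Printing Implicit Defensive.

(** Write [a = mu + delta], [b = nu + delta], and [a'], [b'] for the analogous
    vectors of the shape with row [i] removed, all of length [n] and indexed from 0.  A Kostka number vanishes unless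
    its content is nonnegative, so only the permutations [w'] with
    [b (w'^-1 k) <= a k] for all [k] contribute to the immanant character.

    Since [mu_i = nu_i], i.e. [a i = b i], and [a], [b] strictly decrease, such
    a [w'] sends each of [{k < i}], [{i}], [{k > i}] to itself
    ([blocks_of_entry]).  After the deletion the last index takes over the role
    of [i], because there both parts are [mu_n = nu_n], beyond the length of the
    shape; a contributing permutation again preserves [{k < i}], the middle
    block, and the singleton [{n - 1}] ([blocks_of_entry_del]).

    The permutation [last_to i], which sends the last index to [i] and keeps the
    order of all the others, matches the two families of blocks.  Under it [a]
    and [b] agree with [a'] and [b'] on the first block, both lose 1 on the
    middle block, and both differences vanish on the singleton: so for a
    block-preserving permutation the content at [w' ^ last_to i] of the original
    shape is, up to moving a zero from position [i] to the end, the content at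
    [w'] of the new one ([entry_diff]).  Moving a zero entry does not change a
    Kostka number ([kostka_relabel]): the tableaux just get their letters
    renamed increasingly.  Hence the two sums over the conjugacy class agree
    after the substitution [w' := w' ^ last_to i], term by term
    ([kostka_delete]). *)

Lemma eq_kostka theta n (f g : 'I_n -> int) :
  f =1 g -> kostka theta f = kostka theta g.
Proof.
move=> fg; rewrite /kostka; congr (#|pred_of_set _|).
apply/setP => T; rewrite !inE; congr (_ && _).
by apply: eq_forallb => k; rewrite fg.
Qed.

Lemma kostka_content_ge0 theta n (f : 'I_n -> int) :
  kostka theta f != 0 -> forall k, (0 <= f k)%R.
Proof.
rewrite -lt0n => /card_gt0P[T]; rewrite inE => /andP[_ /forallP cT] k.
by have /eqP <- := cT k.
Qed.

(** Renaming the letters of a tableau by [s] keeps it semistandard as soon as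
    [s] is increasing on the letters that occur, which are those with nonzero
    content. *)
Lemma kostka_relabel theta n (f : 'I_n -> int) (s : 'S_n) :
    (forall j k, f (s j) <> 0%R -> f (s k) <> 0%R -> (s j < s k) = (j < k)) ->
  kostka theta f = kostka theta (f \o s).
Proof.
move=> s_mono.
pose relabel (T : {ffun cell theta -> 'I_n}) := [ffun x => s (T x)].
have relabel_inj : injective relabel.
  move=> T U /ffunP TU; apply/ffunP => x; have := TU x.
  by rewrite !ffunE => /perm_inj.
rewrite /kostka -(card_preimset _ relabel_inj); congr (#|pred_of_set _|).
apply/setP => T; rewrite !inE.
have -> : has_content (relabel T) f = has_content T (f \o s).
  have cardE j : #|[set x | relabel T x == s j]| = #|[set x | T x == j]|.
    congr (#|pred_of_set _|); apply/setP => x.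
    by rewrite !inE ffunE (inj_eq perm_inj).
  apply/forallP/forallP => cT k; first by rewrite -cardE; apply: cT.
  by rewrite -(permKV s k) cardE; apply: cT.
apply: andb_id2r => /forallP cT.
have used x : f (s (T x)) <> 0%R.
  have /eqP /= <- := cT (T x); apply/eqP; rewrite eqz_nat cards_eq0.
  by apply/set0Pn; exists x; rewrite !inE.
apply: eq_forallb => x; apply: eq_forallb => y; rewrite !ffunE.
by rewrite (leqNgt (s _)) !s_mono // -leqNgt.
Qed.

(** If all values of [a] on [A] lie below all values of [b] off [A], a
    permutation with [b \o s <= a] cannot leave [A], and being injective on a
    finite set it cannot enter [A] either. *)
Lemma perm_stable_of_lt n (a b : 'I_n -> int) (s : 'S_n) (A : pred 'I_n) :
    (forall j, (0 <= a j - b (s j))%R) ->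
    (forall j k, A j -> ~~ A k -> (a j < b k)%R) ->
  forall j, A (s j) = A j.
Proof.
move=> ab_ge0 ab_lt j.
have sA : s @: [set k | A k] = [set k | A k].
  apply/eqP; rewrite eqEcard card_imset ?leqnn ?andbT; last exact: perm_inj.
  apply/subsetP => _ /imsetP[k + ->]; rewrite !inE => Ak.
  by apply/negPn/negP => /(ab_lt _ _ Ak); have := ab_ge0 k; lia.
by have := mem_imset [set k | A k] j (@perm_inj _ s); rewrite sA !inE.
Qed.

Lemma leq_part s j k : is_intpart s -> j <= k -> part s k <= part s j.
Proof.
move=> /andP[s_sorted _] le_jk; rewrite /part.
have [le_sk|lt_ks] := leqP (size s) k; first by rewrite nth_default.
have geq_trans : transitive geq by move=> x y z xy yz; apply: leq_trans xy.
by apply: (sorted_leq_nth geq_trans leqnn); rewrite ?inE ?(leq_ltn_trans le_jk).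
Qed.

Lemma part_delete i s k : part (delete_part i s) k = part s (bump i k).
Proof.
rewrite /part /delete_part nth_cat size_take_min nth_drop /bump.
have [le_is|lt_si] := leqP i (size s).
  case: ltnP => ik; first by rewrite nth_take ?add0n.
  by congr nth; lia.
case: ltnP => sk.
  have ki := ltn_trans sk lt_si.
  by rewrite nth_take // leqNgt ki.
by rewrite !nth_default //; lia.
Qed.

Lemma part_beyond_skew_length mu nu n j :
    is_skew_shape mu nu -> skew_length mu nu <= n -> n <= j ->
  part mu j = part nu j.
Proof.
move=> [_ _ le_nm] len_n le_nj; apply/eqP; rewrite eqn_leq le_nm andbT leqNgt.
apply/negP => lt_nm.
have lt_j : j < size mu.
  by rewrite ltnNge; apply/negP => ?; rewrite /part (nth_default 0 (s := mu)) in lt_nm.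
have := @leq_bigmax_cond _ (fun k : 'I_(size mu) => part nu k < part mu k)
  (fun k => k.+1) (Ordinal lt_j) lt_nm.
by rewrite -/(skew_length mu nu) /=; lia.
Qed.

Lemma bump_lt i k : k < i -> bump i k = k.
Proof. by rewrite /bump ltnNge => /negbTE->. Qed.

Lemma bump_ge i k : i <= k -> bump i k = k.+1.
Proof. by rewrite /bump => ->. Qed.

Lemma max_or_lift n (k : 'I_n.+1) :
  (exists k' : 'I_n, k = lift ord_max k') \/ k = ord_max.
Proof. by case: (unliftP ord_max k) => [k'|] ->; [left; exists k' | right]. Qed.

(** The cycle that moves the last index to [i] and shifts [i, ..., n - 1] up by
    one: deleting row [i] is pulling back along it, up to the
    staircase and the last entry. *)
Definition last_to n (i : 'I_n.+1) : 'S_n.+1 := lift_perm ord_max i 1.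

Lemma last_to_max n (i : 'I_n.+1) : last_to i ord_max = i.
Proof. exact: lift_perm_id. Qed.

Lemma last_to_lift n (i : 'I_n.+1) k : last_to i (lift ord_max k) = lift i k.
Proof. by rewrite lift_perm_lift perm1. Qed.

Lemma last_to_mono n (i j k : 'I_n.+1) :
  j != ord_max -> k != ord_max -> (last_to i j < last_to i k) = (j < k).
Proof.
have [[j' ->]|->] := max_or_lift j; last by rewrite eqxx.
have [[k' ->]|->] := max_or_lift k; last by rewrite eqxx.
by rewrite !last_to_lift !lift_max /= /bump; lia.
Qed.

Section ZeroRow.

Variables (n : nat) (mu nu : seq nat) (i : 'I_n.+1).
Hypotheses (skew_mn : is_skew_shape mu nu) (row_i : part mu i = part nu i).
Hypothesis length_le : skew_length mu nu <= n.+1.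

Let intpart_mu : is_intpart mu. Proof. by case: skew_mn. Qed.
Let intpart_nu : is_intpart nu. Proof. by case: skew_mn. Qed.

(* Both vectors are indexed after the deletion: position [k] of [entry s] is
   position [last_to i k] of the shifted partition [s], so that [ord_max]
   stands for row [i] there and for the row of index [n.+1] in [entry_del]. *)
Let entry (s : seq nat) : 'I_n.+1 -> int := shifted s \o last_to i.
Let entry_del (s : seq nat) : 'I_n.+1 -> int := shifted (delete_part i s).

Let entry_max s : entry s ord_max = Posz (part s i + (n - i)).
Proof. by rewrite /entry /shifted /= last_to_max. Qed.

Let entry_lift s (k : 'I_n) :
  entry s (lift ord_max k) = Posz (part s (bump i k) + (n - bump i k)).
Proof. by rewrite /entry /shifted /= last_to_lift. Qed.

Let entry_del_max s : entry_del s ord_max = Posz (part s n.+1).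
Proof.
rewrite /entry_del /shifted part_delete /delta /= subnn addn0 /bump.
by rewrite -ltnS ltn_ord.
Qed.

Let entry_del_lift s (k : 'I_n) :
  entry_del s (lift ord_max k) = Posz (part s (bump i k) + (n - k)).
Proof. by rewrite /entry_del /shifted part_delete /delta lift_max. Qed.

(** In the indexing after the deletion the blocks are [{k < i}],
    [{i <= k < n}] and [{n}]; the two equivalences say that [s] maps each block
    to itself. *)
Definition preserves_blocks (s : 'S_n.+1) :=
  forall k, ((i <= s k) = (i <= k)) /\ ((s k == ord_max) = (k == ord_max)).

(* Row [i] separates the parts above it from those below it, even between the
   two partitions, because they agree in that row. *)
Let part_mn j k : j <= i -> i <= k -> part mu k <= part nu j.
Proof.
by move=> ji ik; apply: leq_trans (leq_part intpart_nu ji); rewrite -row_i leq_part.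
Qed.

(** Rows at or below [i] in [mu] are too short to dominate rows strictly above
    [i] in [nu], and rows strictly below [i] in [mu] are too short to dominate
    row [i] in [nu]; so the rows [>= i] and the rows [> i] are stable, hence
    also row [i], which is [ord_max] in this indexing. *)
Lemma blocks_of_entry (s : 'S_n.+1) :
  (forall k, (0 <= entry mu k - entry nu (s k))%R) -> preserves_blocks s.
Proof.
move=> ge0.
have blk1 := @perm_stable_of_lt _ _ _ s (fun k => i <= k) ge0.
have blk2 := @perm_stable_of_lt _ _ _ s (fun k => (i <= k) && (k != ord_max)) ge0.
have le_in := leq_ord i.
have {}blk1 k : (i <= s k) = (i <= k).
  apply: blk1 => {}k j.
  have [[j' ->]|->] := max_or_lift j; last by rewrite le_in.
  rewrite entry_lift lift_max -ltnNge => ik ji.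
  have lt_jn := ltn_ord j'; rewrite bump_lt //.
  move: ik; have [[k' ->]|->] := max_or_lift k => ik.
    rewrite entry_lift; rewrite lift_max in ik.
    have := @part_mn j' k'.+1; rewrite bump_ge //; have := ltn_ord k'; lia.
  by rewrite entry_max; have := @part_mn j' i; lia.
have {}blk2 k : (i <= s k) && (s k != ord_max) = (i <= k) && (k != ord_max).
  apply: blk2 => {}k j /andP[].
  have [[k' ->]|->] := max_or_lift k; last by rewrite eqxx.
  rewrite lift_max entry_lift => ik _.
  have lt_kn := ltn_ord k'; rewrite bump_ge //.
  have [[j' ->]|->] := max_or_lift j => ji.
    rewrite entry_lift; rewrite lift_max eq_sym neq_lift andbT -ltnNge in ji.
    rewrite bump_lt //.
    by have := @part_mn j' k'.+1; lia.
  by rewrite entry_max; have := @part_mn i k'.+1; lia.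
move=> k; split=> //; move: (blk2 k); rewrite blk1.
have [ik|ki] := leqP i k; first by move/negb_inj.
by move=> _; apply/eqP/eqP => E; move: (blk1 k); rewrite E; move: ki; rewrite ?E /=; lia.
Qed.

(** Here the singleton is stable because the last entry of the new [mu] is
    [part mu n.+1 = part nu n.+1], strictly below all other entries of the new
    [nu]. *)
Lemma blocks_of_entry_del (s : 'S_n.+1) :
  (forall k, (0 <= entry_del mu k - entry_del nu (s k))%R) -> preserves_blocks s.
Proof.
move=> ge0 k; have le_in := leq_ord i; split.
  apply: (@perm_stable_of_lt _ _ _ s (fun k => i <= k) ge0) => {}k j.
  have [[j' ->]|->] := max_or_lift j; last by rewrite le_in.
  rewrite entry_del_lift lift_max -ltnNge => ik ji.
  have lt_jn := ltn_ord j'; rewrite bump_lt //.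
  move: ik; have [[k' ->]|->] := max_or_lift k => ik.
    rewrite entry_del_lift; rewrite lift_max in ik.
    have := @part_mn j' k'.+1; rewrite bump_ge //; have := ltn_ord k'; lia.
  by rewrite entry_del_max; have := @part_mn j' n.+1; lia.
apply: (@perm_stable_of_lt _ _ _ s (pred1 ord_max) ge0) => {}k j /= /eqP->.
have [[j' ->]|->] := max_or_lift j; last by rewrite eqxx.
rewrite entry_del_max entry_del_lift => _.
have lt_jn := ltn_ord j'.
rewrite (part_beyond_skew_length skew_mn length_le (leqnn _)).
have : bump i j' <= n.+1 by rewrite /bump; lia.
by move/(leq_part intpart_nu); lia.
Qed.

(** Going from one shape to the other changes the entries of [mu] and [nu] on
    one block by the same amount, which cancels when [k] and [s k] lie in the
    same block. *)
Lemma entry_diff (s : 'S_n.+1) k : preserves_blocks s ->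
  (entry mu k - entry nu (s k) = entry_del mu k - entry_del nu (s k))%R.
Proof.
move=> /(_ k); have [[k' ->]|->] := max_or_lift k.
  have [[j' ->]|->] := max_or_lift (s (lift ord_max k')) => -[].
    rewrite !entry_lift !entry_del_lift !lift_max => ij _.
    have := ltn_ord j'; have := ltn_ord k'; rewrite /bump ij; lia.
  by rewrite eqxx eq_sym (negbTE (neq_lift _ _)).
rewrite eqxx => -[_ /eqP->]; rewrite !entry_max !entry_del_max row_i.
by rewrite (part_beyond_skew_length skew_mn length_le (leqnn _)); lia.
Qed.

(** Conjugation by [last_to i] turns the pairing of rows prescribed by [w] after
    the deletion into a pairing of rows of the original shape.  If either
    Kostka number is nonzero then [w^-1] preserves the blocks, and then the
    contents differ only by the position of one zero. *)
Lemma kostka_delete theta (w : 'S_n.+1) :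
  kostka theta (fun k => shifted mu k
                         - perm_act (w ^ last_to i)%g (shifted nu) k)%R =
  kostka theta (fun k => shifted (delete_part i mu) k
                         - perm_act w (shifted (delete_part i nu)) k)%R.
Proof.
set f := (fun k => _); set g := (fun k => _).
have fE k : f (last_to i k) = (entry mu k - entry nu ((w^-1)%g k))%R.
  by rewrite /f /perm_act /entry /= -conjVg conjgE !permM permK.
have blocks : kostka theta f != 0 \/ kostka theta g != 0 ->
    preserves_blocks (w^-1)%g.
  case=> /kostka_content_ge0 nz; last exact: blocks_of_entry_del.
  by apply: blocks_of_entry => k; rewrite -fE.
suff fg : preserves_blocks (w^-1)%g -> kostka theta f = kostka theta g.
  have [f0|nz] := eqVneq (kostka theta f) 0; last by apply/fg/blocks; left.
  have [g0|nz] := eqVneq (kostka theta g) 0; last by apply/fg/blocks; right.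
  by rewrite f0 g0.
move=> {}blocks.
(* The content at row [i] is zero, so [last_to i] need only be increasing off
   [ord_max]. *)
have f_max k : f (last_to i k) <> 0%R -> k != ord_max.
  move=> nz; apply/eqP => k_max; apply: nz; rewrite fE k_max.
  have [_] := blocks ord_max; rewrite eqxx => /eqP->.
  by rewrite !entry_max row_i; lia.
rewrite (@kostka_relabel _ _ _ (last_to i)); last first.
  by move=> j k /f_max jm /f_max km; apply: last_to_mono.
by apply: eq_kostka => k /=; rewrite fE entry_diff.
Qed.

End ZeroRow.

Theorem proposition3p1 (n N : nat) (mu nu : seq nat) (i : 'I_n)
    (hskew : is_skew_shape mu nu)
    (hsize : skew_size mu nu = N)
    (hlen : (skew_length mu nu <= n)%N)
    (hi : part mu i = part nu i) :
  forall (w : 'S_n) (theta : seq nat), is_intpart_of N theta ->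
    imm_char theta mu nu w
    = imm_char theta (delete_part i mu) (delete_part i nu) w.
Proof.
case: n i hlen hi => [[]//|n] i hlen hi w theta _.
rewrite /imm_char; congr (_ * _)%R.
rewrite (reindex_inj (conjg_inj (last_to i))) /=.
apply: eq_big => [u|u _]; last by rewrite kostka_delete.
have classN := class_norm w [set: 'S_n.+1]%G.
by rewrite memJ_norm // (subsetP classN) ?inE.
Qed.
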